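(* Let $R$ be a commutative ring with identity and let $n\ge 2$ be an integer. Then $\mathrm{diam}(\overline{\mathrm{APOG}}(M_{n}(R)))\ge \mathrm{diam}(\mathrm{AG}(R))=\mathrm{diam}(\overline{\mathrm{APOG}}(R))$.
   Context: $M_n(R)$ is the ring of $n\times n$ matrices over $R$. For a ring $T$ with identity, $\mathrm{IPO}(T)$ is the set of all $A\subseteq T$ of the form $A=IJ$ where each of $I,J$ is a left or a right ideal of $T$; the product of additive subgroups is the set of finite sums of products. $\overline{\mathrm{APOG}}(T)$ is the undirected graph whose vertices are the nonzero $A\in\mathrm{IPO}(T)$ for which there is a nonzero $B\in\mathrm{IPO}(T)$ with $AB=0$ or $BA=0$; two distinct vertices $A,B$ are adjacent iff $AB=0$ or $BA=0$. For a commutative ring $R$, $\mathrm{AG}(R)$ is the undirected graph whose vertices are the nonzero ideals of $R$ with nonzero annihilator, distinct vertices $I,J$ being adjacent iff $IJ=(0)$. $\mathrm{diam}$ is the supremum of the distances between vertices. *)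

(* Defs.v *)
From HB Require Import structures.
From mathcomp Require Import all_boot all_order all_algebra.
From mathcomp Require Import all_classical all_reals ereal.

Set Implicit Arguments.
Unset Strict Implicit.
Unset Printing Implicit Defensive.

Import Order.TTheory GRing.Theory Num.Theory.

Local Open Scope classical_set_scope.
Local Open Scope ring_scope.

Record graph := Graph {
  carrier : Type;
  vertex : set carrier;
  adj : carrier -> carrier -> Prop;
  adj_vertex : forall u v, adj u v -> vertex u /\ vertex v;
  adj_sym : forall u v, adj u v -> adj v u;
  adj_irrefl : forall u, ~ adj u u }.

Section Diameter.
Variable G : graph.

Fixpoint walk (k : nat) (u v : carrier G) : Prop :=
  if k is k'.+1 then exists2 w, adj u w & walk k' w v else u = v.

Variable K : realType.

(* The distance is +oo when no walk joins u to v, as ereal_inf set0 = +oo. *)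
Definition dist (u v : carrier G) : \bar K :=
  ereal_inf [set k%:R%:E | k in [set k : nat | walk k u v]].

(* The supremum is taken in [0, +oo], so a graph with no vertex has diameter
   0; without the extra point 0 it would be ereal_sup set0 = -oo. *)
Definition diam : \bar K :=
  ereal_sup (0%:E |` [set d | exists u v,
    [/\ @vertex G u, @vertex G v & d = dist u v]]).

End Diameter.

Arguments diam : clear implicits.

Section Ideals.
Variable T : pzRingType.
Implicit Types I J A B : set T.

Definition left_ideal I : Prop :=
  [/\ I 0, forall x y, I x -> I y -> I (x - y)
         & forall r x, I x -> I (r * x)].

Definition right_ideal I : Prop :=
  [/\ I 0, forall x y, I x -> I y -> I (x - y)
         & forall r x, I x -> I (x * r)].

Definition ideal I : Prop := left_ideal I /\ right_ideal I.

Definition prod_set A B : set T :=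
  [set x | exists (k : nat) (a b : 'I_k -> T),
    (forall i, A (a i) /\ B (b i)) /\ x = \sum_(i < k) a i * b i].

Definition IPO : set (set T) :=
  [set A | exists I J, [/\ left_ideal I \/ right_ideal I,
                           left_ideal J \/ right_ideal J
                         & A = prod_set I J]].

Definition APOG_vertex A : Prop :=
  [/\ IPO A, A <> [set 0] &
      exists B, [/\ IPO B, B <> [set 0] &
                    prod_set A B = [set 0] \/ prod_set B A = [set 0]]].

Definition APOG_adj A B : Prop :=
  [/\ APOG_vertex A, APOG_vertex B, A <> B &
      prod_set A B = [set 0] \/ prod_set B A = [set 0]].

Fact APOG_adj_vertex A B : APOG_adj A B -> APOG_vertex A /\ APOG_vertex B.
Proof. by case. Qed.

Fact APOG_adj_sym A B : APOG_adj A B -> APOG_adj B A.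
Proof.
by case=> vA vB neAB AB0; split=> // [/esym //|]; case: AB0; [right|left].
Qed.

Fact APOG_adj_irrefl A : ~ APOG_adj A A.
Proof. by case. Qed.

Definition APOG : graph := Graph APOG_adj_vertex APOG_adj_sym APOG_adj_irrefl.

End Ideals.

Section AnnihilatingIdealGraph.
Variable R : comPzRingType.
Implicit Types I J : set R.

Definition ann I : set R := [set r | forall x, I x -> r * x = 0].

Definition AG_vertex I : Prop :=
  [/\ ideal I, I <> [set 0] & ann I <> [set 0]].

Definition AG_adj I J : Prop :=
  [/\ AG_vertex I, AG_vertex J, I <> J & prod_set I J = [set 0]].

Fact AG_adj_vertex I J : AG_adj I J -> AG_vertex I /\ AG_vertex J.
Proof. by case. Qed.

Fact AG_adj_sym I J : AG_adj I J -> AG_adj J I.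
Proof.
have prodC (A B : set R) : prod_set A B `<=` prod_set B A.
  move=> x [k [a [b [Hab ->]]]]; exists k, b, a; split.
    by move=> i; case: (Hab i).
  by apply: eq_bigr => i _; rewrite mulrC.
case=> vI vJ neIJ IJ0; split=> // [/esym //|].
by rewrite -IJ0; apply/seteqP; split; apply: prodC.
Qed.

Fact AG_adj_irrefl I : ~ AG_adj I I.
Proof. by case. Qed.

Definition AG : graph := Graph AG_adj_vertex AG_adj_sym AG_adj_irrefl.

End AnnihilatingIdealGraph.

(* Main.v *)
Require Import Defs.
From HB Require Import structures.
From mathcomp Require Import all_boot all_order all_algebra.
From mathcomp Require Import all_classical all_reals ereal.

(** Over a commutative ring every product of one-sided ideals is an ideal, and
    an ideal has nonzero annihilator exactly when some nonzero ideal kills it;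
    so the graphs [APOG R] and [AG R] have the same vertices and edges, which
    gives the equality of diameters.

    For the inequality, send an ideal [I] to the set [mx_ideal I] of the
    matrices with entries in [I].  This takes vertices of [AG R] to vertices of
    [APOG 'M[R]_n], and it suffices that it does not shorten distances.  A
    one-sided product in the matrix ring can vanish although the entries of the
    factors have nonzero products, so a long walk between [mx_ideal I] and
    [mx_ideal J] says nothing about [R].  But [mx_ideal I] contains the scalar
    matrices over [I]; if it kills a set of matrices on either side, then [I]
    kills all their entries.  Hence walks of length at most 2 come from walks
    in [AG R] (lemma [mx_ideal_walk]): the middle vertex of a walk of length 2
    has a nonzero entry, which kills both [I] and [J].  Longer walks are handled
    by the classical bound [AG_walk_le3] on the diameter of [AG R]: two vertices
    are joined by a walk of length at most 3. *)

Set Implicit Arguments.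
Unset Strict Implicit.
Unset Printing Implicit Defensive.

Import Order.TTheory GRing.Theory Num.Theory.

Local Open Scope classical_set_scope.
Local Open Scope ring_scope.

(** * Comparison of diameters *)

(** Walks between images under [f] need not be images of walks; only their
    length matters. *)
Lemma le_diam (K : realType) (G H : graph) (f : carrier G -> carrier H) :
    (forall u, @vertex G u -> @vertex H (f u)) ->
    (forall u v k, @vertex G u -> @vertex G v -> @walk H k (f u) (f v) ->
       exists2 k', (k' <= k)%N & @walk G k' u v) ->
  (diam G K <= diam H K)%E.
Proof.
move=> fV fW; apply: ge_ereal_sup => d [-> | [u [v [uV vV ->]]]].
  by apply: ereal_sup_ubound; left.
apply: (@le_trans _ _ (dist K (f u) (f v))); last first.
  by apply: ereal_sup_ubound; right; exists (f u), (f v); split=> //; apply: fV.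
apply: le_ereal_inf_tmp => _ [k /= /(fW _ _ _ uV vV) [k' lek'k walk_k'] <-].
apply: (@le_trans _ _ (k'%:R%:E)%E); last by rewrite lee_fin ler_nat.
by apply: ereal_inf_lbound; exists k'.
Qed.

(** * Products of one-sided ideals *)

Section ProductSet.
Variable T : pzRingType.
Implicit Types A B I J : set T.

Lemma prod_set_eq0 A B :
  prod_set A B = [set 0] <-> forall a b, A a -> B b -> a * b = 0.
Proof.
split=> [AB0 a b Aa Bb | AB0].
  have: prod_set A B (a * b).
    exists 1%N, (fun=> a), (fun=> b); split=> //.
    by rewrite big_ord1.
  by rewrite AB0.
apply/seteqP; split=> [_ [k [a [b [ABab ->]]]] | _ ->].
  by rewrite big1 // => i _; have [Aa Bb] := ABab i; apply: AB0.
by exists 0%N, (fun=> 0), (fun=> 0); split=> [[]|] //; rewrite big_ord0.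
Qed.

Lemma prod_setD A B x y :
  prod_set A B x -> prod_set A B y -> prod_set A B (x + y).
Proof.
move=> [k [a [b [ABab ->]]]] [l [c [d [ABcd ->]]]].
pose glue (f : 'I_k -> T) (g : 'I_l -> T) (i : 'I_(k + l)) :=
  match fintype.split i with inl j => f j | inr j => g j end.
exists (k + l)%N, (glue a c), (glue b d); split=> [i|].
  by rewrite /glue; case: (fintype.split i).
rewrite big_split_ord /glue; congr (_ + _); apply: eq_bigr => i _.
  by rewrite -[lshift l i]/(unsplit (inl i)) unsplitK.
by rewrite -[rshift k i]/(unsplit (inr i)) unsplitK.
Qed.

Lemma ex_nonzero A : A 0 -> A <> [set 0] -> exists2 x, A x & x <> 0.
Proof.
move=> A0 An0; apply: contrapT => noA; apply: An0; apply/seteqP.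
split=> [x Ax | _ -> //]; apply: contrapT => xn0; apply: noA.
by exists x.
Qed.

Lemma nonzero_neq_set0 A x : A x -> x <> 0 -> A <> [set 0].
Proof. by move=> Ax xn0 A0; apply: xn0; move: Ax; rewrite A0. Qed.

Lemma left_ideal_sum I k (f : 'I_k -> T) :
  left_ideal I -> (forall i, I (f i)) -> I (\sum_(i < k) f i).
Proof.
move=> [I0 IB _] If; apply: (big_ind I) => // x y Ix Iy.
by rewrite -[y]opprK; apply: (IB) => //; rewrite -sub0r; apply: IB.
Qed.

Lemma ideal_IPO I : ideal I -> IPO I.
Proof.
move=> idI; exists I, setT; split; first by left; case: idI.
  by left.
have [lI [_ _ IM]] := idI.
apply/seteqP; split=> [x Ix | _ [k [a [b [Iab ->]]]]].
  by exists 1%N, (fun=> x), (fun=> 1); split=> //; rewrite big_ord1 mulr1.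
by apply: left_ideal_sum => // i; apply: IM; case: (Iab i).
Qed.

Lemma IPO0 A : IPO A -> A 0.
Proof.
by move=> [I [J [_ _ ->]]]; exists 0%N, (fun=> 0), (fun=> 0);
  split=> [[]|] //; rewrite big_ord0.
Qed.

End ProductSet.

(** * The two graphs of a commutative ring *)

Section CommutativeRing.
Variable R : comPzRingType.
Implicit Types I J A B : set R.

Lemma onesided_ideal I : left_ideal I \/ right_ideal I -> ideal I.
Proof.
by move=> [] [I0 IB IM]; split; split=> // r x Ix; rewrite mulrC; apply: IM.
Qed.

Lemma IPO_ideal A : IPO A <-> ideal A.
Proof.
split; last exact: ideal_IPO.
move=> [I [J [/onesided_ideal [[I0 IB IM] _] _ ->]]].
have prodM r x : prod_set I J x -> prod_set I J (r * x).
  move=> [k [a [b [IJab ->]]]]; exists k, (fun i => r * a i), b; split=> [i|].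
    by have [Ia Jb] := IJab i; split=> //; apply: IM.
  by rewrite mulr_sumr; apply: eq_bigr => i _; rewrite mulrA.
apply: onesided_ideal; left; split=> //.
  by exists 0%N, (fun=> 0), (fun=> 0); split=> [[]|] //; rewrite big_ord0.
move=> x y IJx IJy; apply: prod_setD => //.
by rewrite -mulN1r; apply: prodM.
Qed.

Lemma ann_ideal I : ideal (ann I).
Proof.
apply: onesided_ideal; left; split=> [x _|r s rI sI x Ix|r s sI x Ix].
- by rewrite mul0r.
- by rewrite mulrBl rI // sI // subrr.
- by rewrite -mulrA sI // mulr0.
Qed.

Lemma ideal_setI I J : ideal I -> ideal J -> ideal (I `&` J).
Proof.
move=> [[I0 IB IM] _] [[J0 JB JM] _]; apply: onesided_ideal; left.
split=> // [x y [Ix Jx] [Iy Jy] | r x [Ix Jx]].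
  by split; [apply: IB | apply: JB].
by split; [apply: IM | apply: JM].
Qed.

Lemma AG_vertexP I : AG_vertex I <->
  [/\ ideal I, exists2 x, I x & x <> 0 & exists2 r, ann I r & r <> 0].
Proof.
split=> [[idI In0 An0] | [idI [x Ix xn0] [r Ar rn0]]].
  split=> //; apply: ex_nonzero => //; first by case: idI => -[].
  by case: (ann_ideal I) => -[].
by split=> //; [apply: nonzero_neq_set0 Ix xn0 | apply: nonzero_neq_set0 Ar rn0].
Qed.

(** A step from a vertex to itself can be dropped from a walk, so an upper
    bound on the length only requires consecutive vertices to have zero product,
    whether they are distinct or not.  This removes the case distinctions on
    coinciding ideals from the constructions of walks below. *)
Lemma AG_walk_cons k I J A :
    AG_vertex I -> AG_vertex J -> (forall x y, I x -> J y -> x * y = 0) ->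
    (exists2 k', (k' <= k)%N & @walk (AG R) k' J A) ->
  exists2 k', (k' <= k.+1)%N & @walk (AG R) k' I A.
Proof.
move=> vI vJ IJ0 [k' lek'k wJA]; have [IJ | nIJ] := pselect (I = J).
  by exists k'; [apply: leqW | rewrite IJ].
by exists k'.+1 => //; exists J => //; split=> //; apply/prod_set_eq0.
Qed.

Lemma AG_walk_refl I : exists2 k, (k <= 0)%N & @walk (AG R) k I I.
Proof. by exists 0%N. Qed.

Lemma AG_walk_le1 I J :
    AG_vertex I -> AG_vertex J -> (forall x y, I x -> J y -> x * y = 0) ->
  exists2 k, (k <= 1)%N & @walk (AG R) k I J.
Proof. by move=> vI vJ IJ0; apply: AG_walk_cons IJ0 (AG_walk_refl J). Qed.

(** The ideal [ann I `&` ann J] is the middle vertex. *)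
Lemma AG_walk_le2 I J r :
    AG_vertex I -> AG_vertex J -> ann I r -> ann J r -> r <> 0 ->
  exists2 k, (k <= 2)%N & @walk (AG R) k I J.
Proof.
move=> vI vJ rI rJ rn0; pose N := ann I `&` ann J.
have vN : AG_vertex N.
  apply/AG_vertexP; split; last 1 first.
  - have /AG_vertexP[_ [x Ix xn0] _] := vI.
    by exists x => // s [sI _]; rewrite mulrC sI.
  - by apply: ideal_setI; apply: ann_ideal.
  - by exists r.
apply: (AG_walk_cons (J := N)) => //.
  by move=> x y Ix [yI _]; rewrite mulrC yI.
by apply: AG_walk_le1 => // x y [_ xJ]; apply: xJ.
Qed.

Lemma AG_vertex_ann I : AG_vertex I -> AG_vertex (ann I).
Proof.
move=> /AG_vertexP[_ [x Ix xn0] annI]; apply/AG_vertexP; split=> //.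
  exact: ann_ideal.
by exists x => // s sI; rewrite mulrC sI.
Qed.

(** Either [ann I] and [ann J] share a nonzero element, or their product, lying
    in the zero intersection, vanishes and [I, ann I, ann J, J] is a walk up to
    repetitions. *)
Lemma AG_walk_le3 I J : AG_vertex I -> AG_vertex J ->
  exists2 k, (k <= 3)%N & @walk (AG R) k I J.
Proof.
move=> vI vJ.
have [[r [rI rJ rn0]] | annIJ0] :=
  pselect (exists r, [/\ ann I r, ann J r & r <> 0]).
  have [k lek2 wk] := AG_walk_le2 vI vJ rI rJ rn0.
  by exists k => //; apply: leqW.
have vAI := AG_vertex_ann vI; have vAJ := AG_vertex_ann vJ.
apply: (AG_walk_cons vI vAI) => [x y Ix yI|]; first by rewrite mulrC yI.
apply: (AG_walk_cons vAI vAJ) => [r s rI sJ|].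
  apply: contrapT => rsn0; apply: annIJ0; exists (r * s); split=> // x Xx.
    by rewrite mulrAC rI // mul0r.
  by rewrite -mulrA sJ // mulr0.
by apply: AG_walk_le1 => // x y xJ; apply: xJ.
Qed.

Lemma APOG_vertex_comm A : APOG_vertex A <-> AG_vertex A.
Proof.
split=> [[/IPO_ideal idA An0 [B [ipoB Bn0 AB0]]] | [idA An0 annA]].
  have [b Bb bn0] := ex_nonzero (IPO0 ipoB) Bn0.
  split=> //; apply: (nonzero_neq_set0 (x := b)) => // x Ax.
  by case: AB0 => /prod_set_eq0 AB0; [rewrite mulrC|]; apply: AB0.
split=> //; first exact/IPO_ideal.
exists (ann A); split=> //; first exact/IPO_ideal/ann_ideal.
by right; apply/prod_set_eq0 => r x rA; apply: rA.
Qed.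

Lemma APOG_adj_comm A B : APOG_adj A B <-> AG_adj A B.
Proof.
split=> [[/APOG_vertex_comm vA /APOG_vertex_comm vB nAB AB0] | [vA vB nAB AB0]].
  split=> //; case: AB0 => // /prod_set_eq0 BA0; apply/prod_set_eq0 => a b Aa Bb.
  by rewrite mulrC BA0.
by split=> //; [exact/APOG_vertex_comm | exact/APOG_vertex_comm | left].
Qed.

Lemma APOG_walk_comm k A B : @walk (APOG R) k A B <-> @walk (AG R) k A B.
Proof.
elim: k A => [|k IHk] A //=.
by split=> -[C /APOG_adj_comm adjAC /IHk wCB]; exists C.
Qed.

Lemma diam_APOG_comm (K : realType) : diam (AG R) K = diam (APOG R) K.
Proof.
apply/le_anti/andP; split.
  apply: (@le_diam K (AG R) (APOG R) id) => [A | A B k _ _ wAB].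
    by move/APOG_vertex_comm.
  by exists k => //; apply/APOG_walk_comm.
apply: (@le_diam K (APOG R) (AG R) id) => [A | A B k _ _ wAB].
  by move/APOG_vertex_comm.
by exists k => //; apply/APOG_walk_comm.
Qed.

End CommutativeRing.

(** * Ideals of the matrix ring *)

Section MatrixRing.
Variables (R : comPzRingType) (n : nat).
Hypothesis n_gt0 : (0 < n)%N.
Implicit Types (I J : set R) (A : set 'M[R]_n).

Definition mx_ideal I : set 'M[R]_n := [set M | forall i j, I (M i j)].

Lemma mx_idealP I : ideal I -> ideal (mx_ideal I).
Proof.
move=> [lI [_ _ IMr]]; have [I0 IB IMl] := lI.
split; split=> [i j|M N IM IN i j|M N IN i j]; rewrite !mxE //.
- exact: IB.
- by apply: left_ideal_sum => // k; apply: IMl.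
- exact: IB.
- by apply: left_ideal_sum => // k; apply: IMr.
Qed.

Lemma mx_ideal_scalar I a : I 0 -> I a -> mx_ideal I a%:M.
Proof. by move=> I0 Ia i j; rewrite mxE; case: (i == j). Qed.

Lemma scalar_mx_neq0 (a : R) : a <> 0 -> a%:M <> 0 :> 'M[R]_n.
Proof.
move=> an0 /matrixP /(_ (Ordinal n_gt0) (Ordinal n_gt0)).
by rewrite !mxE eqxx.
Qed.

Lemma mx_ideal_vertex I : AG_vertex I -> APOG_vertex (mx_ideal I).
Proof.
have nonzero J : ideal J -> (exists2 x, J x & x <> 0) -> mx_ideal J <> [set 0].
  move=> [[J0 _ _] _] [x Jx xn0].
  exact: nonzero_neq_set0 (mx_ideal_scalar J0 Jx) (scalar_mx_neq0 xn0).
move=> /AG_vertexP[idI In0 annI]; split; last exists (mx_ideal (ann I)).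
- exact/ideal_IPO/mx_idealP.
- exact: nonzero.
- split; first exact/ideal_IPO/mx_idealP/ann_ideal.
    by apply: nonzero => //; apply: ann_ideal.
  right; apply/prod_set_eq0 => M N MI NI; apply/matrixP => i j.
  by rewrite !mxE big1 // => k _; apply: (MI i k).
Qed.

(** Scalar matrices over [I] turn either one-sided condition into the same
    two-sided statement about entries. *)
Lemma mx_ideal_ann_entry I A M i j : ideal I ->
    prod_set (mx_ideal I) A = [set 0] \/ prod_set A (mx_ideal I) = [set 0] ->
  A M -> ann I (M i j).
Proof.
move=> [[I0 _ _] _] IA0 AM a Ia; have IaM := mx_ideal_scalar I0 Ia.
case: IA0 => /prod_set_eq0 IA0.
  by have /matrixP/(_ i j) := IA0 _ _ IaM AM;
    rewrite -[_ * _]/(_ *m _) mul_scalar_mx !mxE mulrC.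
have /matrixP/(_ i j) := IA0 _ _ AM IaM.
by rewrite -[_ * _]/(_ *m _) mul_mx_scalar !mxE mulrC.
Qed.

Lemma mx_ideal_inj I J : ideal I -> ideal J -> mx_ideal I = mx_ideal J -> I = J.
Proof.
have sub I' J' : ideal I' -> mx_ideal I' = mx_ideal J' -> I' `<=` J'.
  move=> [[I0 _ _] _] IJ x Ix; have := mx_ideal_scalar I0 Ix.
  rewrite IJ => /(_ (Ordinal n_gt0) (Ordinal n_gt0)).
  by rewrite mxE eqxx.
by move=> idI idJ IJ; apply/seteqP; split; apply: sub.
Qed.

(** Walks of length at least 3 need no transfer since distances in [AG R] are at
    most 3.  In a shorter walk every edge has [mx_ideal I] or [mx_ideal J] as an
    end, so [mx_ideal_ann_entry] applies to it. *)
Lemma mx_ideal_walk I J k : AG_vertex I -> AG_vertex J ->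
    @walk (APOG 'M[R]_n) k (mx_ideal I) (mx_ideal J) ->
  exists2 k', (k' <= k)%N & @walk (AG R) k' I J.
Proof.
move=> vI vJ; have [[idI _ _] [idJ _ _]] := (vI, vJ).
case: k => [/(mx_ideal_inj idI idJ) -> | [|[|k]]]; first exact: AG_walk_refl.
- move=> [B [_ _ _ IJ0] /= BJ]; subst B; apply: AG_walk_le1 => // x y Ix Jy.
  have [[J0 _ _] _] := idJ; pose i0 := Ordinal n_gt0.
  have := mx_ideal_ann_entry i0 i0 idI IJ0 (mx_ideal_scalar J0 Jy).
  by rewrite mxE eqxx mulrC; apply.
- move=> [A [_ [ipoA An0 _] _ IA0] [B [_ _ _ AJ0] /= BJ]].
  subst B.
  have [M AM Mn0] := ex_nonzero (IPO0 ipoA) An0.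
  have [i [j Mijn0]] : exists i j, M i j <> 0.
    apply: contrapT => M0; apply: Mn0; apply/matrixP => i j; rewrite mxE.
    by apply: contrapT => Mij; apply: M0; exists i, j.
  apply: (AG_walk_le2 vI vJ _ _ Mijn0); apply: mx_ideal_ann_entry AM => //.
  by case: AJ0; [right | left].
- move=> _; have [k' lek'3 wk'] := AG_walk_le3 vI vJ.
  by exists k' => //; apply: leq_trans lek'3 _.
Qed.

End MatrixRing.

Theorem theorem4p2 (K : realType) (R : comPzRingType) (n : nat) (hn : (2 <= n)%N) :
  (diam (APOG 'M[R]_n) K >= diam (AG R) K)%E /\
  diam (AG R) K = diam (APOG R) K.
Proof.
have n_gt0 : (0 < n)%N by apply: leq_trans hn.
split; last exact: diam_APOG_comm.
apply: (@le_diam K (AG R) (APOG 'M[R]_n) (@mx_ideal R n)) => [I|I J k].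
  exact: mx_ideal_vertex.
exact: mx_ideal_walk.
Qed.
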